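(* Let $0<q<1$, $\nu\in\mathbb{C}$ and $z\in\mathbb{C}\setminus\{0\}$ (with the same choice of branch of $z^\nu$ on both sides). Then $$I_{\nu}^{(2)}(2z;q)=\frac{z^\nu}{(q;q)_\infty}\;{}_1\phi_1(z^2;0;q,q^{\nu+1}).$$ In particular, for every integer $n\ge 0$, $$I_{\nu}^{(2)}(2q^{-n/2};q)=\frac{q^{\nu n/2}\,S_{n}(-q^{-\nu-n};q)}{(q^{n+1};q)_{\infty}}$$ and $$I_{\nu}^{(2)}(2q^{-n/2};q)=\frac{q^{-\nu n/2}\,S_{n}(-q^{\nu-n};q)}{(q^{n+1};q)_{\infty}}.$$
   Context: Notation: $(a;q)_0=1$, $(a;q)_n=\prod_{j=0}^{n-1}(1-aq^j)$, $(a;q)_\infty=\prod_{j\ge0}(1-aq^j)$, $(a_1,\dots,a_r;q)_n=\prod_i(a_i;q)_n$, and $\genfrac{[}{]}{0pt}{}{n}{k}_q=\frac{(q;q)_n}{(q;q)_k(q;q)_{n-k}}$ for $0\le k\le n$. The modified $q$-Bessel function is $$I_\nu^{(2)}(z;q)=\frac{(q^{\nu+1};q)_\infty}{(q;q)_\infty}\sum_{n=0}^\infty\frac{q^{n(n+\nu)}}{(q,q^{\nu+1};q)_n}(z/2)^{\nu+2n},$$ where $(q^{\nu+1};q)_\infty/(q^{\nu+1};q)_n$ is understood as $(q^{\nu+n+1};q)_\infty$ (this covers negative integers $\nu$). The basic hypergeometric series is ${}_1\phi_1(a;b;q,z)=\sum_{k=0}^\infty\frac{(a;q)_k}{(q,b;q)_k}(-1)^kq^{\binom{k}{2}}z^k$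 (with $(0;q)_k=1$). The Stieltjes–Wigert polynomials are $S_n(x;q)=\frac{1}{(q;q)_n}\sum_{k=0}^n\genfrac{[}{]}{0pt}{}{n}{k}_q q^{k^2}(-x)^k$. The value at $z=q^{-n/2}$ uses $(q^{-n/2})^\nu=q^{-n\nu/2}$ (real logarithm of $q$). *)

(* Defs.v *)
From Stdlib Require Import Reals.
From Coquelicot Require Import Coquelicot.

Open Scope C_scope.

(** Coquelicot's limits of sequences and sums of series are total functions on
    real sequences only; as in its [C_lim], they are taken here componentwise. *)
Definition Clim_seq (u : nat -> C) : C :=
  (real (Lim_seq (fun n => Re (u n))), real (Lim_seq (fun n => Im (u n)))).

Definition CSeries (a : nat -> C) : C := Clim_seq (sum_n a).

Lemma Clim_seq_unique (u : nat -> C) (l : C) :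
  filterlim u eventually (locally l) -> Clim_seq u = l.
Proof.
  intros H.
  assert (HR : is_lim_seq (fun n => Re (u n)) (Re l)).
  { apply is_lim_seq_spec; intros eps.
    generalize (proj1 (filterlim_locally u l) H eps).
    apply filter_imp; intros n [Hn _]; exact Hn. }
  assert (HI : is_lim_seq (fun n => Im (u n)) (Im l)).
  { apply is_lim_seq_spec; intros eps.
    generalize (proj1 (filterlim_locally u l) H eps).
    apply filter_imp; intros n [_ Hn]; exact Hn. }
  unfold Clim_seq; rewrite (is_lim_seq_unique _ _ HR), (is_lim_seq_unique _ _ HI).
  destruct l; reflexivity.
Qed.

Lemma CSeries_unique (a : nat -> C) (l : C) : is_series a l -> CSeries a = l.
Proof. exact (Clim_seq_unique (sum_n a) l). Qed.

Definition Cexp (z : C) : C :=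
  ((exp (Re z) * cos (Im z))%R, (exp (Re z) * sin (Im z))%R).

(** A choice, at every nonzero point, of a complex logarithm; no continuity is
    required, so every choice of branch at every point is covered. *)
Definition is_log (lg : C -> C) : Prop :=
  forall w : C, w <> 0 -> Cexp (lg w) = w.

Definition cpow (lg : C -> C) (z s : C) : C := Cexp (s * lg z).

(** [q^s] for real [q > 0], with the real logarithm of [q]. *)
Definition qpow (q : R) (s : C) : C := Cexp (s * ln q).

Fixpoint qpoch (a : C) (q : R) (n : nat) : C :=
  match n with
  | O => 1
  | S m => qpoch a q m * (1 - a * q ^ m)
  end.

Definition qpoch_inf (a : C) (q : R) : C := Clim_seq (qpoch a q).

Definition qbinom (q : R) (n k : nat) : C :=
  qpoch q q n / (qpoch q q k * qpoch q q (n - k)).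

(** The factor [(q^(nu+1);q)_oo / (q^(nu+1);q)_n] of the defining series is
    written [(q^(nu+n+1);q)_oo], which also makes sense when [nu] is a negative
    integer. The logarithm [lg] determines the power [(z/2)^(nu+2n)]. *)
Definition qbesselI2 (lg : C -> C) (nu z : C) (q : R) : C :=
  / qpoch_inf q q *
  CSeries (fun n : nat =>
    qpoch_inf (qpow q (nu + INR n + 1)) q / qpoch q q n
    * qpow q (INR n * (INR n + nu))
    * cpow lg (z / 2) (nu + 2 * INR n)).

Definition phi11 (a b : C) (q : R) (z : C) : C :=
  CSeries (fun k : nat =>
    qpoch a q k / (qpoch q q k * qpoch b q k)
    * (- (1)) ^ k * q ^ (k * (k - 1) / 2)%nat * z ^ k).

Definition stieltjes_wigert (n : nat) (x : C) (q : R) : C :=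
  / qpoch q q n *
  sum_n (fun k : nat => qbinom q n k * q ^ (k * k)%nat * (- x) ^ k) n.

(* Main.v *)
Require Import Defs.
From Stdlib Require Import Reals Lra Lia.
From Coquelicot Require Import Coquelicot.

Open Scope C_scope.

(** Write [x = q^(nu+1)] and [a = z^2]. After the factor
    [z^nu / (q;q)_oo] is removed, the first identity reads
<<
  sum_n (x q^n;q)_oo q^(n(n-1)) (x a)^n / (q;q)_n
    = sum_k (a;q)_k (-1)^k q^(k(k-1)/2) x^k / (q;q)_k.
>>
    Expanding [(x q^n;q)_oo] by Euler and [(a;q)_k] by the q-binomial theorem
    turns both sides into one double series. That rearrangement is replaced here
    by a finite version of the identity,
<<
  sum_(n <= N) [N,n] (x q^n;q)_(N-n) q^(n(n-1)) (x a)^n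
    = sum_(k <= N) [N,k] (a;q)_k (-1)^k q^(k(k-1)/2) x^k,
>>
    where [[N,k]] is the Gaussian binomial coefficient. By the Pascal rule
    both sides satisfy, as functions of [x],
<<
  T_(N+1)(x) = (1 - x q^N) T_N(x) + a x q^N T_N(q x),   T_0 = 1,
>>
    so they agree for every [N] ([bessel_trunc_eq_phi11_trunc]). Then [N] tends to
    infinity. Since [[N,k] -> 1/(q;q)_k] with [0 <= [N,k] <= 1/(q;q)_k], and the
    q-shifted factorials are bounded uniformly in their length, both sums are
    dominated by a multiple of the convergent series of
    [q^(k(k-1)/2) r^k / (q;q)_k], and Tannery's theorem ([tannery]) gives
    [bessel_phi11]. The case [a = 0] of the finite identity is the q-binomial
    theorem; the same passage to the limit then shows that [(x;q)_N] converges,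
    so that [qpoch_inf] is the limit that it should be ([qpoch_Ccv]).

    At [z = q^(-n/2)] the parameter [a = q^(-n)] makes the series stop at [k = n],
    because [(q^(-n);q)_k q^(nk) = (q;q)_k [n,k] (-1)^k q^(k(k-1)/2)]
    ([qpoch_neg_power]). What remains is the Stieltjes-Wigert sum at [q^(nu-n)], and
    [(q;q)_oo = (q;q)_n (q^(n+1);q)_oo] gives the formula with
    [q^(-nu n/2)]. The formula with [q^(nu n/2)] is the same sum read backwards,
    [k -> n-k] ([wigert_sum_reverse]). *)

(** * Limits of complex sequences *)

(** Convergence is measured by the modulus: this form turns the limits needed below
    into squeeze arguments on real sequences. *)
Definition Ccv (u : nat -> C) (l : C) : Prop :=
  is_lim_seq (fun n => Cmod (u n - l)) 0%R.

Lemma Ccv_filterlim (u : nat -> C) (l : C) :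
  Ccv u l -> filterlim u eventually (locally l).
Proof.
  intros H; apply filterlim_locally; intros eps.
  apply is_lim_seq_spec in H.
  generalize (H eps); apply filter_imp; intros n Hn.
  apply C_NormedModule_mixin_compat1.
  rewrite Rminus_0_r, Rabs_pos_eq in Hn by apply Cmod_ge_0; exact Hn.
Qed.

Lemma filterlim_Ccv (u : nat -> C) (l : C) :
  filterlim u eventually (locally l) -> Ccv u l.
Proof.
  intros H; apply is_lim_seq_spec; intros eps.
  assert (Hs : (0 < sqrt 2)%R) by (apply sqrt_lt_R0; lra).
  assert (He : (0 < eps / sqrt 2)%R)
    by (apply Rdiv_lt_0_compat; [apply cond_pos | exact Hs]).
  generalize (proj1 (filterlim_locally u l) H (mkposreal _ He)).
  apply filter_imp; intros n Hn.
  rewrite Rminus_0_r, Rabs_pos_eq by apply Cmod_ge_0.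
  apply C_NormedModule_mixin_compat2 in Hn; simpl in Hn.
  (* [sqrt 2] is the constant between the modulus and the componentwise balls of [C]. *)
  replace (pos eps) with (sqrt 2 * (eps / sqrt 2))%R by (field; lra).
  exact Hn.
Qed.

Lemma Ccv_Clim_seq (u : nat -> C) (l : C) : Ccv u l -> Clim_seq u = l.
Proof. intros H; apply Clim_seq_unique, Ccv_filterlim, H. Qed.

Lemma Ccv_unique (u : nat -> C) (l m : C) : Ccv u l -> Ccv u m -> l = m.
Proof.
  intros H1 H2.
  rewrite <- (Ccv_Clim_seq u l H1); exact (Ccv_Clim_seq u m H2).
Qed.

Lemma Ccv_const (c : C) : Ccv (fun _ => c) c.
Proof.
  unfold Ccv; apply (is_lim_seq_ext (fun _ => 0%R)); [ | apply is_lim_seq_const].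
  intros n; replace (c - c) with (RtoC 0) by ring; now rewrite Cmod_0.
Qed.

Lemma Ccv_ext_loc (u v : nat -> C) (l : C) :
  eventually (fun n => u n = v n) -> Ccv u l -> Ccv v l.
Proof.
  intros H; apply is_lim_seq_ext_loc.
  revert H; apply filter_imp; intros n ->; reflexivity.
Qed.

Lemma Ccv_RtoC (u : nat -> R) (l : R) : is_lim_seq u l -> Ccv (fun n => RtoC (u n)) l.
Proof.
  intros H; unfold Ccv.
  apply (is_lim_seq_ext (fun n => Rabs (u n - l))).
  { intros n; now rewrite <- RtoC_minus, Cmod_R. }
  rewrite <- Rabs_R0; apply (is_lim_seq_abs _ 0%R).
  replace 0%R with (l - l)%R by ring.
  apply is_lim_seq_minus'; [exact H | apply is_lim_seq_const].
Qed.

Lemma Ccv_mult (u v : nat -> C) (l m : C) :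
  Ccv u l -> Ccv v m -> Ccv (fun n => u n * v n) (l * m).
Proof.
  unfold Ccv; intros Hu Hv.
  apply (is_lim_seq_le_le (fun _ => 0%R) _
    (fun n => Cmod (u n - l) * Cmod (v n - m) + Cmod l * Cmod (v n - m)
              + Cmod m * Cmod (u n - l))%R).
  - intros n; split; [apply Cmod_ge_0 | ].
    replace (u n * v n - l * m)
      with ((u n - l) * (v n - m) + l * (v n - m) + m * (u n - l)) by ring.
    rewrite <- !Cmod_mult.
    eapply Rle_trans; [apply Cmod_triangle | ].
    apply Rplus_le_compat_r, Cmod_triangle.
  - apply is_lim_seq_const.
  - replace 0%R with (0 * 0 + Cmod l * 0 + Cmod m * 0)%R by ring.
    apply is_lim_seq_plus'; [apply is_lim_seq_plus' | ].
    + now apply is_lim_seq_mult'.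
    + apply (is_lim_seq_scal_l _ (Cmod l) 0%R Hv).
    + apply (is_lim_seq_scal_l _ (Cmod m) 0%R Hu).
Qed.

Lemma Ccv_bounded (u : nat -> C) (l : C) (b : R) :
  Ccv u l -> (forall n, Cmod (u n) <= b)%R -> (Cmod l <= b)%R.
Proof.
  intros H Hb.
  assert (H' : is_lim_seq (fun n => b + Cmod (u n - l))%R (b + 0)%R)
    by (apply is_lim_seq_plus'; [apply is_lim_seq_const | exact H]).
  rewrite Rplus_0_r in H'.
  apply (is_lim_seq_le (fun _ => Cmod l) _ (Cmod l) b) in H'; trivial.
  - intros n; replace l with (u n + - (u n - l)) at 1 by ring.
    eapply Rle_trans; [apply Cmod_triangle | ].
    rewrite Cmod_opp; apply Rplus_le_compat_r, Hb.
  - apply is_lim_seq_const.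
Qed.

(** * Finite complex sums *)

Lemma Csum_S (f : nat -> C) (n : nat) : sum_n f (S n) = sum_n f n + f (S n).
Proof. exact (sum_Sn f n). Qed.

Lemma Csum_mult_l (c : C) (f : nat -> C) (n : nat) :
  sum_n (fun k => c * f k) n = c * sum_n f n.
Proof. exact (sum_n_mult_l (K := C_Ring) c f n). Qed.

Lemma Csum_plus (f g : nat -> C) (n : nat) :
  sum_n (fun k => f k + g k) n = sum_n f n + sum_n g n.
Proof. exact (sum_n_plus (G := C_AbelianMonoid) f g n). Qed.

Lemma Csum_ext_loc (f g : nat -> C) (n : nat) :
  (forall k, (k <= n)%nat -> f k = g k) -> sum_n f n = sum_n g n.
Proof. exact (sum_n_ext_loc (G := C_AbelianMonoid) f g n). Qed.

(** A sum has its type stated through Coquelicot's monoid structure on [C], which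
    hides the ring structure of [C] from [ring]. *)
Ltac Cring :=
  match goal with |- @eq _ ?a ?b => change (@eq C a b) end; ring.

Lemma Csum_head (f : nat -> C) (n : nat) :
  sum_n f (S n) = f 0%nat + sum_n (fun k => f (S k)) n.
Proof.
  induction n as [ | n IH].
  - now rewrite Csum_S, !sum_O.
  - rewrite Csum_S, IH, Csum_S; Cring.
Qed.

Lemma Csum_rev (f : nat -> C) (n : nat) :
  sum_n f n = sum_n (fun k => f (n - k)%nat) n.
Proof.
  revert f; induction n as [ | n IH]; intros f.
  - now rewrite !sum_O.
  - rewrite Csum_S, Csum_head, IH, Nat.sub_0_r, Cplus_comm; reflexivity.
Qed.

Lemma Cmod_Csum (f : nat -> C) (n : nat) :
  (Cmod (sum_n f n) <= sum_n (fun k => Cmod (f k)) n)%R.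
Proof.
  induction n as [ | n IH].
  - rewrite !sum_O; apply Rle_refl.
  - rewrite Csum_S, (sum_Sn (fun k => Cmod (f k))).
    eapply Rle_trans; [apply Cmod_triangle | ].
    apply Rplus_le_compat_r, IH.
Qed.

(** * Tannery's theorem *)

Lemma is_lim_seq_sum_n_null (d : nat -> nat -> R) (K : nat) :
  (forall k, is_lim_seq (fun N => d N k) 0%R) ->
  is_lim_seq (fun N => sum_n (d N) K) 0%R.
Proof.
  intros H; induction K as [ | K IH].
  - apply (is_lim_seq_ext (fun N => d N 0%nat)); [ | apply H].
    intros N; now rewrite sum_O.
  - apply (is_lim_seq_ext (fun N => sum_n (d N) K + d N (S K))%R).
    { intros N; now rewrite sum_Sn. }
    replace 0%R with (0 + 0)%R by ring; now apply is_lim_seq_plus'.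
Qed.

(** Past an index [K] the terms contribute at most the tail of [sum M], whatever [N]
    is; up to [K] only finitely many terms remain, each tending to [0]. *)
Lemma tannery_null (d : nat -> nat -> R) (M : nat -> R) :
  ex_series M ->
  (forall N k, 0 <= d N k <= M k)%R ->
  (forall k, is_lim_seq (fun N => d N k) 0%R) ->
  is_lim_seq (fun N => sum_n (d N) N) 0%R.
Proof.
  intros [s Hs] Hd Hlim.
  assert (HM : forall k, (0 <= M k)%R)
    by (intros k; destruct (Hd 0%nat k); lra).
  assert (Hnn : forall f n, (forall k, 0 <= f k)%R -> (0 <= sum_n f n)%R).
  { intros f n Hf; induction n as [ | n IH].
    - rewrite sum_O; apply Hf.
    - rewrite sum_Sn; unfold plus; simpl; generalize (Hf (S n)); lra. }
  apply is_lim_seq_spec; intros eps.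
  assert (He : (0 < eps / 3)%R) by (generalize (cond_pos eps); lra).
  assert (HsM : is_lim_seq (sum_n M) s) by exact Hs.
  apply is_lim_seq_spec in HsM.
  destruct (HsM (mkposreal _ He)) as [K HK]; simpl in HK.
  pose proof (is_lim_seq_sum_n_null d K Hlim) as HF.
  apply is_lim_seq_spec in HF.
  destruct (HF (mkposreal _ He)) as [K' HK']; simpl in HK'.
  exists (max K K'); intros N HN.
  assert (Hsplit : forall p,
    (sum_n (d N) (K + p) <= sum_n (d N) K + (sum_n M (K + p) - sum_n M K))%R).
  { intros p; induction p as [ | p IH].
    - rewrite Nat.add_0_r; lra.
    - rewrite <- plus_n_Sm, !sum_Sn; unfold plus; simpl.
      destruct (Hd N (S (K + p))); lra. }
  specialize (Hsplit (N - K)%nat).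
  replace (K + (N - K))%nat with N in Hsplit by lia.
  pose proof (HK N ltac:(lia)) as H1.
  pose proof (HK K ltac:(lia)) as H2.
  pose proof (HK' N ltac:(lia)) as H3.
  pose proof (Hnn (d N) N (fun k => proj1 (Hd N k))) as H4.
  rewrite Rminus_0_r in *; rewrite Rabs_pos_eq by exact H4.
  apply Rabs_def2 in H1; apply Rabs_def2 in H2; apply Rabs_def2 in H3; lra.
Qed.

(** Dominated convergence for series whose range of summation grows with [N]. The
    same majorant makes the limit series converge, so that its [CSeries] is a true
    sum: this is the first half of the conclusion. *)
Lemma tannery (f : nat -> nat -> C) (g : nat -> C) (M : nat -> R) :
  ex_series M ->
  (forall N k, Cmod (f N k) <= M k)%R ->
  (forall k, Ccv (fun N => f N k) (g k)) ->
  Ccv (sum_n g) (CSeries g) /\ Ccv (fun N => sum_n (f N) N) (CSeries g).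
Proof.
  intros HM Hf Hg.
  assert (Hgb : forall k, (Cmod (g k) <= M k)%R)
    by (intros k; apply (Ccv_bounded _ _ _ (Hg k)); intros N; apply Hf).
  assert (Hs : Ccv (sum_n g) (CSeries g)).
  { destruct (ex_series_le (V := C_CompleteNormedModule) g M) as [l Hl].
    - intros k; exact (Hgb k).
    - exact HM.
    - rewrite (CSeries_unique g l Hl); apply filterlim_Ccv, Hl. }
  split; [exact Hs | ].
  assert (Hd : is_lim_seq (fun N => sum_n (fun k => Cmod (f N k - g k)) N) 0%R).
  { apply (tannery_null _ (fun k => 2 * M k)%R).
    - destruct HM as [s HM]; exists (2 * s)%R; exact (is_series_scal 2%R M s HM).
    - intros N k; split; [apply Cmod_ge_0 | ].
      eapply Rle_trans; [apply Cmod_triangle | ].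
      rewrite Cmod_opp; generalize (Hf N k) (Hgb k); lra.
    - exact Hg. }
  unfold Ccv in *.
  apply (is_lim_seq_le_le (fun _ => 0%R) _
    (fun N => sum_n (fun k => Cmod (f N k - g k)) N + Cmod (sum_n g N - CSeries g))%R).
  - intros N; split; [apply Cmod_ge_0 | ].
    assert (E : sum_n (f N) N = sum_n (fun k => f N k - g k) N + sum_n g N).
    { rewrite <- Csum_plus; apply Csum_ext_loc; intros k _; ring. }
    rewrite E.
    replace (sum_n (fun k => f N k - g k) N + sum_n g N - CSeries g)
      with (sum_n (fun k => f N k - g k) N + (sum_n g N - CSeries g)) by ring.
    eapply Rle_trans; [apply Cmod_triangle | ].
    apply Rplus_le_compat_r, Cmod_Csum.
  - apply is_lim_seq_const.
  - replace 0%R with (0 + 0)%R by ring; now apply is_lim_seq_plus'.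
Qed.

(** * Gaussian binomial coefficients *)

Definition tri (k : nat) : nat := (k * (k - 1) / 2)%nat.

Lemma tri_S (k : nat) : tri (S k) = (tri k + k)%nat.
Proof.
  unfold tri.
  replace (S k * (S k - 1))%nat with (k * (k - 1) + k * 2)%nat
    by (destruct k; simpl; nia).
  now rewrite Nat.div_add by lia.
Qed.

Lemma tri_double (k : nat) : (tri k + tri k = k * (k - 1))%nat.
Proof.
  induction k as [ | k IH]; [reflexivity | ].
  rewrite !tri_S; destruct k; simpl in *; nia.
Qed.

(** The Gaussian binomial coefficient, defined by the Pascal rule so that it vanishes
    for [k > n]. Sums over [k <= n] may then be extended or shifted freely, and the
    truncated difference [m - j] is only ever read where [j <= m] or multiplied by
    [0]. It is real-valued because its sign and size matter for the majorants. *)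
Fixpoint gbin (q : R) (n k : nat) : R :=
  match n, k with
  | _, O => 1
  | O, S _ => 0
  | S m, S j => gbin q m (S j) + q ^ (m - j) * gbin q m j
  end%R.

(** The number [(q;q)_k], kept real so that it can be compared with [0] and [1]. *)
Fixpoint qfac (q : R) (k : nat) : R :=
  match k with
  | O => 1
  | S m => qfac q m * (1 - q * q ^ m)
  end%R.

Lemma gbin_0 (q : R) (n : nat) : gbin q n 0 = 1%R.
Proof. destruct n; reflexivity. Qed.

Lemma gbin_gt (q : R) (n k : nat) : (n < k)%nat -> gbin q n k = 0%R.
Proof.
  revert k; induction n as [ | n IH]; intros [ | k] H; try lia; [reflexivity | ].
  simpl; rewrite !IH by lia; ring.
Qed.

Lemma gbin_pascal (q : R) (n k : nat) :
  RtoC (gbin q (S n) (S k)) = gbin q n (S k) + q ^ (n - k) * gbin q n k.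
Proof. simpl gbin; now rewrite RtoC_plus, RtoC_mult, RtoC_pow. Qed.

Lemma gbin_pascal_R (q : R) (n k : nat) :
  gbin q (S n) (S k) = (gbin q n (S k) + q ^ (n - k) * gbin q n k)%R.
Proof. reflexivity. Qed.

(** The ratio of consecutive coefficients. It gives the limit and the bound of
    [gbin q n k] in [n] through products of [k] factors. The induction needs the
    companion rule [(1 - q^(n+1-k)) [n+1,k] = (1 - q^(n+1)) [n,k]], derived
    inside the step. *)
Lemma gbin_absorb (q : R) (n k : nat) :
  ((1 - q ^ S k) * gbin q n (S k) = (1 - q ^ (n - k)) * gbin q n k)%R.
Proof.
  revert k; induction n as [ | n IH]; intros k.
  - simpl gbin; rewrite Nat.sub_0_l; simpl pow; ring.
  - destruct (Nat.le_gt_cases k n) as [Hk | Hk].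
    2: { rewrite (gbin_gt q (S n) (S k)) by lia.
         replace (S n - k)%nat with 0%nat by lia; simpl pow; ring. }
    assert (H : ((1 - q ^ (S n - k)) * gbin q (S n) k
                 = (1 - q ^ S n) * gbin q n k)%R).
    { destruct k as [ | j]; [rewrite !gbin_0, Nat.sub_0_r; ring | ].
      rewrite gbin_pascal_R.
      replace (S n - S j)%nat with (n - j)%nat by lia.
      specialize (IH j).
      replace (q ^ S n)%R with (q ^ (n - j) * q ^ S j)%R
        by (rewrite <- pow_add; f_equal; lia).
      replace ((1 - q ^ (n - j)) * (gbin q n (S j) + q ^ (n - j) * gbin q n j))%R
        with ((1 - q ^ (n - j)) * gbin q n (S j)
              + q ^ (n - j) * ((1 - q ^ (n - j)) * gbin q n j))%R by ring.
      rewrite <- IH; ring. }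
    rewrite H, gbin_pascal_R, Rmult_plus_distr_l, IH.
    replace (q ^ S n)%R with (q ^ (n - k) * q ^ S k)%R
      by (rewrite <- pow_add; f_equal; lia).
    ring.
Qed.

Lemma pow_in_01 (q : R) (k : nat) : (0 < q < 1)%R -> (0 < q ^ S k < 1)%R.
Proof.
  intros hq; split; [apply pow_lt; lra | ].
  induction k as [ | k IH]; [simpl; lra | ].
  simpl pow in *; assert (0 < q ^ k)%R by (apply pow_lt; lra); nra.
Qed.

Lemma qfac_pos (q : R) (k : nat) : (0 < q < 1)%R -> (0 < qfac q k)%R.
Proof.
  intros hq; induction k as [ | k IH]; [simpl; lra | ].
  simpl qfac; apply Rmult_lt_0_compat; [exact IH | ].
  generalize (pow_in_01 q k hq); simpl pow; lra.
Qed.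

Lemma qpoch_qfac (q : R) (k : nat) : qpoch q q k = qfac q k.
Proof.
  induction k as [ | k IH]; [reflexivity | ].
  simpl; now rewrite IH, RtoC_mult, RtoC_minus, RtoC_mult, RtoC_pow.
Qed.

Lemma gbin_nonneg (q : R) (n k : nat) : (0 < q < 1)%R -> (0 <= gbin q n k)%R.
Proof.
  intros hq; revert k; induction n as [ | n IH]; intros [ | k]; simpl; try lra.
  apply Rplus_le_le_0_compat; [apply IH | ].
  apply Rmult_le_pos; [apply pow_le; lra | apply IH].
Qed.

Lemma gbin_S_qfac (q : R) (n k : nat) :
  (gbin q n (S k) * qfac q (S k) = (1 - q ^ (n - k)) * (gbin q n k * qfac q k))%R.
Proof.
  simpl qfac; change (q * q ^ k)%R with (q ^ S k)%R.
  transitivity (((1 - q ^ S k) * gbin q n (S k)) * qfac q k)%R; [ring | ].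
  rewrite gbin_absorb; ring.
Qed.

Lemma gbin_qfac_le_1 (q : R) (n k : nat) :
  (0 < q < 1)%R -> (0 <= gbin q n k * qfac q k <= 1)%R.
Proof.
  intros hq; split.
  - apply Rmult_le_pos; [now apply gbin_nonneg | now apply Rlt_le, qfac_pos].
  - induction k as [ | k IH]; [rewrite gbin_0; simpl; lra | ].
    rewrite gbin_S_qfac.
    assert (0 <= gbin q n k * qfac q k)%R
      by (apply Rmult_le_pos; [now apply gbin_nonneg | now apply Rlt_le, qfac_pos]).
    assert (0 < q ^ (n - k))%R by (apply pow_lt; lra); nra.
Qed.

Lemma gbin_le (q : R) (n k : nat) : (0 < q < 1)%R -> (gbin q n k <= / qfac q k)%R.
Proof.
  intros hq; pose proof (qfac_pos q k hq).
  apply (Rmult_le_reg_r (qfac q k)); [assumption | ].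
  rewrite Rinv_l by lra; now apply gbin_qfac_le_1.
Qed.

Lemma is_lim_seq_shift (u : nat -> R) (l : R) (k : nat) :
  is_lim_seq u l -> is_lim_seq (fun n => u (n - k)%nat) l.
Proof.
  intros H; apply (is_lim_seq_incr_n _ k).
  apply (is_lim_seq_ext u); [ | exact H].
  intros n; f_equal; lia.
Qed.

Lemma gbin_lim (q : R) (k : nat) :
  (0 < q < 1)%R -> is_lim_seq (fun n => gbin q n k) (/ qfac q k)%R.
Proof.
  intros hq.
  assert (H : is_lim_seq (fun n => gbin q n k * qfac q k)%R 1%R).
  { induction k as [ | k IH].
    - apply (is_lim_seq_ext (fun _ => 1%R)); [ | apply is_lim_seq_const].
      intros n; rewrite gbin_0; simpl; ring.
    - apply (is_lim_seq_ext (fun n => (1 - q ^ (n - k)) * (gbin q n k * qfac q k))%R).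
      { intros n; now rewrite gbin_S_qfac. }
      replace (Finite 1) with (Finite ((1 - 0) * 1)) by (f_equal; ring).
      apply is_lim_seq_mult'; [ | exact IH].
      apply is_lim_seq_minus'; [apply is_lim_seq_const | ].
      apply (is_lim_seq_shift (fun n => q ^ n)%R).
      apply is_lim_seq_geom; rewrite Rabs_pos_eq; lra. }
  pose proof (qfac_pos q k hq).
  apply (is_lim_seq_ext (fun n => gbin q n k * qfac q k * / qfac q k)%R).
  { intros n; field; lra. }
  replace (Finite (/ qfac q k)) with (Finite (1 * / qfac q k)) by (f_equal; ring).
  apply is_lim_seq_mult'; [exact H | apply is_lim_seq_const].
Qed.

Lemma gbin_qfac (q : R) (n k : nat) : (k <= n)%nat ->
  (gbin q n k * qfac q k * qfac q (n - k) = qfac q n)%R.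
Proof.
  induction k as [ | k IH]; intros H.
  - rewrite gbin_0, Nat.sub_0_r; simpl; ring.
  - rewrite <- IH, gbin_S_qfac by lia.
    replace (n - k)%nat with (S (n - S k)) by lia; simpl; ring.
Qed.

Lemma qbinom_gbin (q : R) (n k : nat) :
  (0 < q < 1)%R -> (k <= n)%nat -> qbinom q n k = gbin q n k.
Proof.
  intros hq H; unfold qbinom; rewrite !qpoch_qfac, <- (gbin_qfac q n k H).
  pose proof (qfac_pos q k hq); pose proof (qfac_pos q (n - k) hq).
  rewrite !RtoC_mult; field; split; intros E; apply RtoC_inj in E; lra.
Qed.

(** * The finite identity *)

(** How the Pascal rule acts on sums. The unshifted part [A] loses its last term
    because [[n,n+1] = 0], so both parts are sums of the shorter length again. *)
Lemma Csum_pascal (f A B : nat -> C) (n : nat) :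
  f 0%nat = A 0%nat ->
  (forall k, (k <= n)%nat -> f (S k) = A (S k) + B k) ->
  A (S n) = 0 ->
  sum_n f (S n) = sum_n A n + sum_n B n.
Proof.
  intros H0 HS HA; rewrite Csum_head, H0, (Csum_ext_loc _ _ n HS), Csum_plus.
  rewrite Cplus_assoc, <- Csum_head, Csum_S, HA; Cring.
Qed.

Definition bessel_trunc (q : R) (a x : C) (N n : nat) : C :=
  gbin q N n * qpoch (x * q ^ n) q (N - n) * q ^ (n * (n - 1))%nat * (x * a) ^ n.

Definition phi11_trunc (q : R) (a x : C) (N k : nat) : C :=
  gbin q N k * (- (1)) ^ k * q ^ tri k * x ^ k * qpoch a q k.

(** The unshifted part of the Pascal rule has one factor [1 - x q^N] more in
    [(x q^n;q)_(N+1-n)]; the shifted part has [x q^(n+1) = (q x) q^n] as base. *)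
Lemma bessel_trunc_rec (q : R) (a x : C) (N : nat) :
  sum_n (bessel_trunc q a x (S N)) (S N)
  = (1 - x * q ^ N) * sum_n (bessel_trunc q a x N) N
    + a * x * q ^ N * sum_n (bessel_trunc q a (q * x) N) N.
Proof.
  rewrite <- !Csum_mult_l.
  rewrite (Csum_pascal _
    (fun n => gbin q N n * qpoch (x * q ^ n) q (S N - n)
              * q ^ (n * (n - 1))%nat * (x * a) ^ n)
    (fun n => a * x * q ^ N * bessel_trunc q a (q * x) N n)).
  - f_equal; apply Csum_ext_loc; intros k Hk; unfold bessel_trunc.
    replace (S N - k)%nat with (S (N - k)) by lia; simpl qpoch.
    replace (q ^ N) with (q ^ k * q ^ (N - k)) by (rewrite <- Cpow_add_r; f_equal; lia).
    ring.
  - unfold bessel_trunc; now rewrite !gbin_0.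
  - intros k Hk; unfold bessel_trunc.
    rewrite gbin_pascal, !(Cpow_mult_l _ _ k), !Cpow_S.
    replace (S N - S k)%nat with (N - k)%nat by lia.
    replace (S k * (S k - 1))%nat with (k * (k - 1) + k + k)%nat
      by (destruct k; simpl; nia).
    replace (q ^ N) with (q ^ k * q ^ (N - k)) by (rewrite <- Cpow_add_r; f_equal; lia).
    replace (q * x * q ^ k) with (x * (q * q ^ k)) by ring.
    rewrite !Cpow_add_r, Cpow_mult_l; ring.
  - rewrite gbin_gt by lia; ring.
Qed.

(** The shifted part carries [(a;q)_(k+1) = (a;q)_k (1 - a q^k)]. The [1] reproduces
    the sum at [x] and the [a q^k] turns [x^k] into [(q x)^k]. *)
Lemma phi11_trunc_rec (q : R) (a x : C) (N : nat) :
  sum_n (phi11_trunc q a x (S N)) (S N)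
  = (1 - x * q ^ N) * sum_n (phi11_trunc q a x N) N
    + a * x * q ^ N * sum_n (phi11_trunc q a (q * x) N) N.
Proof.
  rewrite (Csum_pascal _ (phi11_trunc q a x N)
    (fun k => - (x * q ^ N) * phi11_trunc q a x N k
              + a * x * q ^ N * phi11_trunc q a (q * x) N k)).
  - rewrite Csum_plus, !Csum_mult_l; Cring.
  - unfold phi11_trunc; now rewrite !gbin_0.
  - intros k Hk; unfold phi11_trunc.
    rewrite gbin_pascal, !Cpow_S, tri_S, Cpow_add_r, Cpow_mult_l; simpl qpoch.
    replace (q ^ N) with (q ^ k * q ^ (N - k)) by (rewrite <- Cpow_add_r; f_equal; lia).
    ring.
  - unfold phi11_trunc; rewrite gbin_gt by lia; ring.
Qed.

Lemma bessel_trunc_eq_phi11_trunc (q : R) (a x : C) (N : nat) :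
  sum_n (bessel_trunc q a x N) N = sum_n (phi11_trunc q a x N) N.
Proof.
  revert x; induction N as [ | N IH]; intros x.
  - rewrite !sum_O; unfold bessel_trunc, phi11_trunc; simpl; Cring.
  - now rewrite bessel_trunc_rec, phi11_trunc_rec, !IH.
Qed.

(** * Passage to the limit *)

Lemma exp_le_compat (x y : R) : (x <= y)%R -> (exp x <= exp y)%R.
Proof.
  intros [H | ->]; [now apply Rlt_le, exp_increasing | apply Rle_refl].
Qed.

(** From [1 + t <= exp t] and the geometric series. The bound does not depend on [n],
    which is what domination requires. *)
Lemma Cmod_qpoch (q : R) (x : C) (n : nat) : (0 < q < 1)%R ->
  (Cmod (qpoch x q n) <= exp (Cmod x / (1 - q)))%R.
Proof.
  intros hq; pose proof (Cmod_ge_0 x) as Hx.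
  apply Rle_trans with (exp (Cmod x * ((1 - q ^ n) / (1 - q))))%R.
  - induction n as [ | n IH].
    + simpl; rewrite Cmod_1.
      replace (Cmod x * ((1 - 1) / (1 - q)))%R with 0%R by (field; lra).
      rewrite exp_0; lra.
    + simpl qpoch; rewrite Cmod_mult.
      replace (Cmod x * ((1 - q ^ S n) / (1 - q)))%R
        with (Cmod x * ((1 - q ^ n) / (1 - q)) + Cmod x * q ^ n)%R
        by (simpl; field; lra).
      rewrite exp_plus.
      apply Rmult_le_compat; [apply Cmod_ge_0 | apply Cmod_ge_0 | exact IH | ].
      eapply Rle_trans; [apply Cmod_triangle | ].
      rewrite Cmod_opp, Cmod_mult, Cmod_1, Cmod_pow, Cmod_R, Rabs_pos_eq by lra.
      apply exp_ineq1_le.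
  - apply exp_le_compat; apply Rmult_le_compat_l; [exact Hx | ].
    assert (0 < q ^ n)%R by (apply pow_lt; lra).
    apply (Rmult_le_reg_r (1 - q)); [lra | ].
    unfold Rdiv; rewrite Rmult_assoc, Rinv_l by lra; lra.
Qed.

Definition majorant (q r : R) (k : nat) : R := (/ qfac q k * q ^ tri k * r ^ k)%R.

(** The ratio of consecutive terms is [q^k r / (1 - q^(k+1))], which tends to [0]. *)
Lemma ex_series_majorant (q r : R) :
  (0 < q < 1)%R -> (0 < r)%R -> ex_series (majorant q r).
Proof.
  intros hq hr.
  assert (Hp : forall k, (0 < majorant q r k)%R).
  { intros k; unfold majorant.
    repeat apply Rmult_lt_0_compat; try (apply pow_lt; lra).
    now apply Rinv_0_lt_compat, qfac_pos. }
  apply (ex_series_ext (fun k => Rabs (majorant q r k))).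
  { intros k; apply Rabs_pos_eq, Rlt_le, Hp. }
  apply (ex_series_DAlembert _ 0%R); [lra | | ].
  { intros k; generalize (Hp k); lra. }
  (* [q^(k(k+1)/2) / q^(k(k-1)/2) = q^k] *)
  apply (is_lim_seq_ext (fun k => q ^ k * r * / (1 - q ^ S k))%R).
  { intros k; rewrite Rabs_pos_eq
      by (apply Rlt_le, Rdiv_lt_0_compat; apply Hp).
    unfold majorant; rewrite tri_S, pow_add; simpl qfac.
    change (q * q ^ k)%R with (q ^ S k)%R.
    pose proof (qfac_pos q k hq); pose proof (pow_in_01 q k hq).
    assert (0 < q ^ tri k)%R by (apply pow_lt; lra).
    assert (0 < r ^ k)%R by (apply pow_lt; lra).
    simpl in *; field; lra. }
  assert (Hg : is_lim_seq (fun n => q ^ n)%R 0%R)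
    by (apply is_lim_seq_geom; rewrite Rabs_pos_eq; lra).
  replace 0%R with (0 * r * / (1 - 0))%R by field.
  apply is_lim_seq_mult'.
  - apply is_lim_seq_mult'; [exact Hg | apply is_lim_seq_const].
  - apply (is_lim_seq_inv _ (1 - 0)%R).
    + apply is_lim_seq_minus'; [apply is_lim_seq_const | ].
      exact (proj1 (is_lim_seq_incr_1 (fun n => q ^ n)%R 0%R) Hg).
    + intros E; injection E; lra.
Qed.

Lemma gbin_Ccv (q : R) (k : nat) : (0 < q < 1)%R ->
  Ccv (fun N => gbin q N k) (/ qpoch q q k).
Proof.
  intros hq; pose proof (qfac_pos q k hq).
  rewrite qpoch_qfac, <- RtoC_inv by lra.
  now apply Ccv_RtoC, gbin_lim.
Qed.

Lemma Cmod_gbin_le (q : R) (n k : nat) : (0 < q < 1)%R ->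
  (Cmod (gbin q n k) <= / qfac q k)%R.
Proof.
  intros hq; rewrite Cmod_R, Rabs_pos_eq by now apply gbin_nonneg.
  now apply gbin_le.
Qed.

Definition phi11_term (q : R) (a x : C) (k : nat) : C :=
  qpoch a q k / (qpoch q q k * qpoch 0 q k)
  * (- (1)) ^ k * q ^ (k * (k - 1) / 2)%nat * x ^ k.

Lemma qpoch_0 (q : R) (k : nat) : qpoch 0 q k = 1.
Proof. induction k as [ | k IH]; [reflexivity | simpl; rewrite IH; ring]. Qed.

Lemma ex_series_scaled_majorant (q r B : R) :
  (0 < q < 1)%R -> (0 < r)%R -> ex_series (fun k => B * majorant q r k)%R.
Proof.
  intros hq hr; destruct (ex_series_majorant q r hq hr) as [s Hs].
  exists (B * s)%R; exact (is_series_scal B _ s Hs).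
Qed.

(** The common shape of the terms of both truncated sums: Gaussian coefficient [g],
    bounded factor [p], a power of [q] at least quadratic in [k], a [k]-th power. *)
Lemma Cmod_term_le (g p y : C) (q r B : R) (k e : nat) : (0 < q < 1)%R ->
  (Cmod g <= / qfac q k)%R -> (Cmod p <= B)%R -> (tri k <= e)%nat ->
  (Cmod y <= r)%R ->
  (Cmod (g * p * q ^ e * y ^ k) <= B * majorant q r k)%R.
Proof.
  intros hq Hg Hp He Hy; unfold majorant.
  rewrite !Cmod_mult, !Cmod_pow, Cmod_R, (Rabs_pos_eq q) by lra.
  pose proof (Cmod_ge_0 g); pose proof (Cmod_ge_0 p); pose proof (Cmod_ge_0 y).
  assert (0 <= q ^ e <= q ^ tri k)%R.
  { split; [apply pow_le; lra | ].
    replace e with (tri k + (e - tri k))%nat by lia; rewrite pow_add.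
    assert (0 < q ^ tri k)%R by (apply pow_lt; lra).
    assert (q ^ (e - tri k) <= 1)%R
      by (rewrite <- (pow1 (e - tri k)); apply pow_incr; lra).
    nra. }
  assert (0 <= Cmod y ^ k <= r ^ k)%R
    by (split; [apply pow_le; lra | apply pow_incr; lra]).
  replace (B * (/ qfac q k * q ^ tri k * r ^ k))%R
    with (/ qfac q k * B * q ^ tri k * r ^ k)%R by ring.
  repeat apply Rmult_le_compat; repeat apply Rmult_le_pos; tauto.
Qed.

Lemma Cmod_signs (k : nat) : Cmod ((- (1)) ^ k) = 1%R.
Proof. rewrite Cmod_pow, Cmod_m1; apply pow1. Qed.

Lemma phi11_trunc_limit (q : R) (a x : C) : (0 < q < 1)%R ->
  Ccv (sum_n (phi11_term q a x)) (phi11 a 0 q x)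
  /\ Ccv (fun N => sum_n (phi11_trunc q a x N) N) (phi11 a 0 q x).
Proof.
  intros hq; pose proof (Cmod_ge_0 x).
  (* [Cmod x + 1] rather than [Cmod x]: the ratio test wants a positive base. *)
  apply (tannery _ _ (fun k => exp (Cmod a / (1 - q)) * majorant q (Cmod x + 1) k)%R).
  - apply ex_series_scaled_majorant; lra.
  - intros N k; unfold phi11_trunc.
    replace (gbin q N k * (- (1)) ^ k * q ^ tri k * x ^ k * qpoch a q k)
      with (gbin q N k * ((- (1)) ^ k * qpoch a q k) * q ^ tri k * x ^ k) by ring.
    apply Cmod_term_le; [exact hq | now apply Cmod_gbin_le | | lia | lra].
    rewrite Cmod_mult, Cmod_signs, Rmult_1_l; now apply Cmod_qpoch.
  - intros k; unfold phi11_trunc, phi11_term; rewrite qpoch_0, Cmult_1_r.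
    fold (tri k).
    replace (qpoch a q k / qpoch q q k * (- (1)) ^ k * q ^ tri k * x ^ k)
      with (/ qpoch q q k * ((- (1)) ^ k * q ^ tri k * x ^ k * qpoch a q k))
      by (unfold Cdiv; ring).
    apply (Ccv_ext_loc
      (fun N => gbin q N k * ((- (1)) ^ k * q ^ tri k * x ^ k * qpoch a q k))).
    { exists 0%nat; intros N _; ring. }
    apply Ccv_mult; [now apply gbin_Ccv | apply Ccv_const].
Qed.

(** The case [a = 0] of the finite identity: on the other side only the term [n = 0]
    survives. *)
Lemma qpoch_q_binomial (q : R) (x : C) (N : nat) :
  qpoch x q N = sum_n (phi11_trunc q 0 x N) N.
Proof.
  rewrite <- bessel_trunc_eq_phi11_trunc.
  assert (H : forall n, sum_n (bessel_trunc q 0 x N) n = qpoch x q N).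
  { induction n as [ | n IH].
    - rewrite sum_O; unfold bessel_trunc; rewrite gbin_0, Nat.sub_0_r; simpl.
      rewrite !Cmult_1_r; Cring.
    - rewrite Csum_S, IH; unfold bessel_trunc; rewrite Cmult_0_r, (Cpow_S 0).
      rewrite Cmult_0_l, Cmult_0_r; Cring. }
  now rewrite H.
Qed.

Lemma qpoch_Ccv (q : R) (x : C) : (0 < q < 1)%R -> Ccv (qpoch x q) (qpoch_inf x q).
Proof.
  intros hq; destruct (phi11_trunc_limit q 0 x hq) as [_ H].
  assert (H' : Ccv (qpoch x q) (phi11 0 0 q x)).
  { revert H; apply Ccv_ext_loc; exists 0%nat; intros N _.
    now rewrite <- qpoch_q_binomial. }
  unfold qpoch_inf; now rewrite (Ccv_Clim_seq _ _ H').
Qed.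

(** The [n]-th term of the Bessel series without [z^nu], for [x = q^(nu+1)] and
    [a = z^2]; here [q^(n(n+nu)) = q^(n(n-1)) x^n]. *)
Definition bessel_term (q : R) (a x : C) (n : nat) : C :=
  qpoch_inf (x * q ^ n) q / qpoch q q n * q ^ (n * (n - 1))%nat * (x * a) ^ n.

Lemma bessel_trunc_limit (q : R) (a x : C) : (0 < q < 1)%R ->
  Ccv (sum_n (bessel_term q a x)) (CSeries (bessel_term q a x))
  /\ Ccv (fun N => sum_n (bessel_trunc q a x N) N) (CSeries (bessel_term q a x)).
Proof.
  intros hq; pose proof (Cmod_ge_0 x); pose proof (Cmod_ge_0 (x * a)).
  apply (tannery _ _
    (fun k => exp (Cmod x / (1 - q)) * majorant q (Cmod (x * a) + 1) k)%R).
  - apply ex_series_scaled_majorant; lra.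
  - intros N k; unfold bessel_trunc.
    apply Cmod_term_le; [exact hq | now apply Cmod_gbin_le | | | lra].
    + eapply Rle_trans; [now apply Cmod_qpoch | apply exp_le_compat].
      apply Rmult_le_compat_r; [apply Rlt_le, Rinv_0_lt_compat; lra | ].
      rewrite Cmod_mult, Cmod_pow, Cmod_R, Rabs_pos_eq by lra.
      assert (q ^ k <= 1)%R by (rewrite <- (pow1 k); apply pow_incr; lra).
      nra.
    + rewrite <- tri_double; lia.
  - intros k; unfold bessel_trunc, bessel_term.
    apply Ccv_mult; [ | apply Ccv_const].
    apply Ccv_mult; [ | apply Ccv_const].
    unfold Cdiv; rewrite (Cmult_comm (qpoch_inf _ _)).
    apply Ccv_mult; [now apply gbin_Ccv | ].
    unfold Ccv; apply (is_lim_seq_shift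
      (fun n => Cmod (qpoch (x * q ^ k) q n - qpoch_inf (x * q ^ k) q))).
    now apply qpoch_Ccv.
Qed.

Lemma bessel_phi11 (q : R) (a x : C) : (0 < q < 1)%R ->
  CSeries (bessel_term q a x) = phi11 a 0 q x.
Proof.
  intros hq; apply (Ccv_unique (fun N => sum_n (bessel_trunc q a x N) N)).
  - now apply bessel_trunc_limit.
  - apply (Ccv_ext_loc (fun N => sum_n (phi11_trunc q a x N) N)).
    + exists 0%nat; intros N _; now rewrite bessel_trunc_eq_phi11_trunc.
    + now apply phi11_trunc_limit.
Qed.

(** * The Bessel function as a 1phi1 series *)

Lemma Cexp_plus (z w : C) : Cexp (z + w) = Cexp z * Cexp w.
Proof.
  unfold Cexp; destruct z as [a b], w as [c d]; simpl.
  rewrite exp_plus, cos_plus, sin_plus.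
  apply injective_projections; simpl; ring.
Qed.

Lemma Cexp_0 : Cexp 0 = 1.
Proof.
  unfold Cexp; simpl; rewrite exp_0, cos_0, sin_0.
  apply injective_projections; simpl; ring.
Qed.

Lemma INR_S_C (n : nat) : RtoC (INR (S n)) = INR n + 1.
Proof. now rewrite S_INR, RtoC_plus. Qed.

Lemma Cexp_INR (n : nat) (z : C) : Cexp (INR n * z) = Cexp z ^ n.
Proof.
  induction n as [ | n IH].
  - simpl INR; rewrite Cmult_0_l; exact Cexp_0.
  - rewrite INR_S_C, Cpow_S, <- IH, <- Cexp_plus; f_equal; ring.
Qed.

Lemma qpow_plus (q : R) (s t : C) : qpow q (s + t) = qpow q s * qpow q t.
Proof. unfold qpow; rewrite <- Cexp_plus; f_equal; ring. Qed.

Lemma qpow_INR_mult (q : R) (n : nat) (s : C) : qpow q (INR n * s) = qpow q s ^ n.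
Proof. unfold qpow; rewrite <- Cexp_INR; f_equal; ring. Qed.

Lemma qpow_1 (q : R) : (0 < q)%R -> qpow q 1 = q.
Proof.
  intros hq; unfold qpow; rewrite Cmult_1_l; unfold Cexp; simpl.
  rewrite exp_ln, cos_0, sin_0 by exact hq.
  apply injective_projections; simpl; ring.
Qed.

Lemma qpow_0 (q : R) : qpow q 0 = 1.
Proof. unfold qpow; rewrite Cmult_0_l; exact Cexp_0. Qed.

Lemma qpow_INR (q : R) (n : nat) : (0 < q)%R -> qpow q (INR n) = q ^ n.
Proof.
  intros hq; rewrite <- (Cmult_1_r (INR n)), qpow_INR_mult, qpow_1 by exact hq.
  reflexivity.
Qed.

Lemma CSeries_scal (c : C) (f : nat -> C) (l : C) :
  Ccv (sum_n f) l -> CSeries (fun n => c * f n) = c * l.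
Proof.
  intros H; unfold CSeries; apply Ccv_Clim_seq.
  apply (Ccv_ext_loc (fun n => c * sum_n f n)).
  - exists 0%nat; intros n _; now rewrite Csum_mult_l.
  - apply Ccv_mult; [apply Ccv_const | exact H].
Qed.

Lemma CSeries_ext (f g : nat -> C) : (forall n, f n = g n) -> CSeries f = CSeries g.
Proof.
  intros H; unfold CSeries, Clim_seq.
  f_equal; f_equal; apply Lim_seq_ext; intros n; now rewrite (sum_n_ext f g n H).
Qed.

Lemma RtoC_neq_0 (x : R) : x <> 0%R -> RtoC x <> 0.
Proof. intros H E; apply H, RtoC_inj, E. Qed.

Lemma qbesselI2_phi11 (q : R) (nu : C) (lg : C -> C) (z : C) :
  (0 < q < 1)%R -> is_log lg -> z <> 0 ->
  qbesselI2 lg nu (2 * z) q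
  = cpow lg z nu / qpoch_inf q q * phi11 (z ^ 2) 0 q (qpow q (nu + 1)).
Proof.
  intros hq hlg hz; unfold qbesselI2.
  replace (2 * z / 2) with z by (field; apply RtoC_neq_0; lra).
  rewrite <- bessel_phi11 by exact hq.
  rewrite (CSeries_ext _
    (fun n => cpow lg z nu * bessel_term q (z ^ 2) (qpow q (nu + 1)) n)).
  - rewrite (CSeries_scal _ _ _ (proj1 (bessel_trunc_limit q _ _ hq))).
    unfold Cdiv; ring.
  - intros n; unfold bessel_term.
    assert (E1 : qpow q (nu + INR n + 1) = qpow q (nu + 1) * q ^ n).
    { rewrite <- qpow_INR, <- qpow_plus by lra; f_equal; ring. }
    assert (E2 : qpow q (INR n * (INR n + nu))
                 = q ^ (n * (n - 1))%nat * qpow q (nu + 1) ^ n).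
    { destruct n as [ | m].
      - simpl; rewrite Cmult_0_l, qpow_0; ring.
      - rewrite qpow_INR_mult, Nat.mul_comm, Cpow_mult_r, <- Cpow_mult_l.
        f_equal; rewrite <- qpow_INR, <- qpow_plus by lra.
        f_equal; simpl Nat.sub; rewrite Nat.sub_0_r, INR_S_C; ring. }
    assert (E3 : cpow lg z (nu + 2 * INR n) = cpow lg z nu * (z ^ 2) ^ n).
    { unfold cpow.
      replace ((nu + 2 * INR n) * lg z)
        with (nu * lg z + INR n * (lg z + lg z)) by ring.
      rewrite Cexp_plus, Cexp_INR, Cexp_plus, hlg by exact hz.
      f_equal; f_equal; simpl; ring. }
    rewrite E1, E2, E3, Cpow_mult_l; unfold Cdiv; ring.
Qed.

(** * Terminating series and Stieltjes-Wigert polynomials *)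

(** The hypothesis says [a = q^(-n)]; the powers of [q] with negative exponent are
    cleared by the factor [q^(n k)]. For [k > n] both sides vanish. *)
Lemma qpoch_neg_power (q : R) (n k : nat) (a : C) : a * q ^ n = 1 ->
  qpoch a q k * q ^ (n * k) = qfac q k * gbin q n k * (- (1)) ^ k * q ^ tri k.
Proof.
  intros ha; induction k as [ | k IH].
  - rewrite gbin_0, Nat.mul_0_r; simpl; ring.
  - assert (H : RtoC (qfac q (S k)) * gbin q n (S k)
                = (1 - q ^ (n - k)) * (gbin q n k * qfac q k)).
    { rewrite <- !RtoC_mult, <- RtoC_pow, <- RtoC_minus, <- RtoC_mult.
      f_equal; rewrite <- gbin_S_qfac; ring. }
    rewrite H, tri_S, Cpow_add_r, (Cpow_S (- (1))).
    simpl qpoch; rewrite Nat.mul_succ_r, Cpow_add_r.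
    replace (qpoch a q k * (1 - a * q ^ k) * (q ^ (n * k) * q ^ n))
      with (qpoch a q k * q ^ (n * k) * (q ^ n - a * q ^ n * q ^ k)) by ring.
    rewrite IH, ha.
    destruct (Nat.le_gt_cases k n) as [Hk | Hk].
    + replace (q ^ n) with (q ^ k * q ^ (n - k))
        by (rewrite <- Cpow_add_r; f_equal; lia).
      ring.
    + rewrite gbin_gt by exact Hk; ring.
Qed.

Lemma CSeries_finite (f : nat -> C) (n : nat) :
  (forall k, (n < k)%nat -> f k = 0) -> CSeries f = sum_n f n.
Proof.
  intros H; unfold CSeries; apply Ccv_Clim_seq.
  apply (Ccv_ext_loc (fun _ => sum_n f n)); [ | apply Ccv_const].
  exists n; intros m Hm; induction Hm as [ | m Hm IH]; [reflexivity | ].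
  rewrite Csum_S, <- IH, H by lia; symmetry; apply Cplus_0_r.
Qed.

(** The sum in the Stieltjes-Wigert polynomial at [-y], without the factor
    [1/(q;q)_n]. *)
Definition wigert_sum (q : R) (n : nat) (y : C) : C :=
  sum_n (fun k => gbin q n k * q ^ (k * k)%nat * y ^ k) n.

Lemma stieltjes_wigert_opp (q : R) (n : nat) (y : C) : (0 < q < 1)%R ->
  stieltjes_wigert n (- y) q = wigert_sum q n y / qfac q n.
Proof.
  intros hq; unfold stieltjes_wigert; rewrite qpoch_qfac.
  unfold Cdiv; rewrite Cmult_comm; f_equal.
  apply Csum_ext_loc; intros k Hk.
  rewrite qbinom_gbin by assumption.
  now replace (- - y) with y by ring.
Qed.

(** With [a = q^(-n)] and argument [y q^(n+1)], the two signs cancel and the exponents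
    add up to [k(k-1)/2 + k(k-1)/2 + k = k^2]. *)
Lemma phi11_terminating (q : R) (n : nat) (a y : C) : (0 < q < 1)%R ->
  a * q ^ n = 1 -> phi11 a 0 q (y * q ^ S n) = wigert_sum q n y.
Proof.
  intros hq ha.
  assert (Hterm : forall k, phi11_term q a (y * q ^ S n) k
                            = gbin q n k * q ^ (k * k)%nat * y ^ k).
  { intros k; unfold phi11_term; fold (tri k).
    rewrite qpoch_0, Cmult_1_r, qpoch_qfac.
    pose proof (RtoC_neq_0 _ (Rgt_not_eq _ _ (qfac_pos q k hq))) as Hk.
    replace (k * k)%nat with (tri k + tri k + k)%nat
      by (rewrite tri_double; destruct k; simpl; nia).
    rewrite Cpow_mult_l, <- Cpow_mult_r.
    replace (S n * k)%nat with (n * k + k)%nat by lia.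
    rewrite !Cpow_add_r.
    transitivity (qpoch a q k * q ^ (n * k) / qfac q k
                  * (- (1)) ^ k * q ^ tri k * q ^ k * y ^ k).
    { field; exact Hk. }
    rewrite (qpoch_neg_power q n k a ha).
    assert (Hsign : (- (1)) ^ k * (- (1)) ^ k = 1).
    { rewrite <- Cpow_mult_l; replace (- (1) * - (1)) with (RtoC 1) by ring.
      apply Cpow_1_l. }
    transitivity (gbin q n k * ((- (1)) ^ k * (- (1)) ^ k)
                  * (q ^ tri k * q ^ tri k * q ^ k) * y ^ k).
    { field; exact Hk. }
    rewrite Hsign; ring. }
  change (CSeries (phi11_term q a (y * q ^ S n)) = wigert_sum q n y).
  rewrite (CSeries_finite _ n).
  - now apply Csum_ext_loc.
  - intros k Hk; rewrite Hterm, gbin_gt by exact Hk; ring.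
Qed.

Lemma gbin_sym (q : R) (n k : nat) : (0 < q < 1)%R -> (k <= n)%nat ->
  gbin q n (n - k) = gbin q n k.
Proof.
  intros hq H.
  pose proof (gbin_qfac q n k H) as H1.
  pose proof (gbin_qfac q n (n - k) ltac:(lia)) as H2.
  replace (n - (n - k))%nat with k in H2 by lia.
  pose proof (qfac_pos q k hq); pose proof (qfac_pos q (n - k) hq).
  apply (Rmult_eq_reg_r (qfac q k * qfac q (n - k)));
    [ | apply Rgt_not_eq, Rmult_lt_0_compat; assumption].
  transitivity (qfac q n); [rewrite <- H2 | rewrite <- H1]; ring.
Qed.

(** Substitute [k -> n-k]. As [y^k y'^k q^(2nk) = 1], the reversed term is
    [[n,k] y^n y'^k] times [q] to the power [(n-k)^2 + 2nk = n^2 + k^2]. *)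
Lemma wigert_sum_reverse (q : R) (n : nat) (y y' : C) : (0 < q < 1)%R ->
  y * y' * q ^ (2 * n) = 1 ->
  wigert_sum q n y = (y * q ^ n) ^ n * wigert_sum q n y'.
Proof.
  intros hq Hy; unfold wigert_sum.
  rewrite Csum_rev, <- Csum_mult_l; apply Csum_ext_loc; intros k Hk.
  rewrite gbin_sym by assumption.
  assert (E : y ^ k * y' ^ k * q ^ (2 * n * k) = 1)
    by (rewrite Cpow_mult_r, <- !Cpow_mult_l, Hy; apply Cpow_1_l).
  transitivity (gbin q n k * q ^ ((n - k) * (n - k)) * y ^ (n - k)
                * (y ^ k * y' ^ k * q ^ (2 * n * k))).
  { rewrite E; ring. }
  rewrite Cpow_mult_l, <- Cpow_mult_r.
  transitivity (gbin q n k * (q ^ ((n - k) * (n - k)) * q ^ (2 * n * k))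
                * (y ^ (n - k) * y ^ k) * y' ^ k); [ring | ].
  rewrite <- !Cpow_add_r.
  replace (n - k + k)%nat with n by lia.
  replace ((n - k) * (n - k) + 2 * n * k)%nat with (n * n + k * k)%nat.
  - rewrite Cpow_add_r; ring.
  - set (m := (n - k)%nat); replace n with (m + k)%nat by (unfold m; lia); ring.
Qed.

Lemma qpoch_add (q : R) (x : C) (n m : nat) :
  qpoch x q (n + m) = qpoch x q n * qpoch (x * q ^ n) q m.
Proof.
  induction m as [ | m IH].
  - rewrite Nat.add_0_r; simpl; ring.
  - rewrite <- plus_n_Sm; simpl; rewrite IH, Cpow_add_r; ring.
Qed.

Lemma qpoch_inf_split (q : R) (x : C) (n : nat) : (0 < q < 1)%R ->
  qpoch_inf x q = qpoch x q n * qpoch_inf (x * q ^ n) q.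
Proof.
  intros hq; apply (Ccv_unique (fun m => qpoch x q (n + m))).
  - unfold Ccv; apply (is_lim_seq_ext
      (fun m => Cmod (qpoch x q (m + n) - qpoch_inf x q))).
    { intros m; now rewrite Nat.add_comm. }
    apply (is_lim_seq_incr_n (fun m => Cmod (qpoch x q m - qpoch_inf x q))).
    now apply qpoch_Ccv.
  - apply (Ccv_ext_loc (fun m => qpoch x q n * qpoch (x * q ^ n) q m)).
    + exists 0%nat; intros m _; now rewrite qpoch_add.
    + apply Ccv_mult; [apply Ccv_const | now apply qpoch_Ccv].
Qed.

Lemma Cinv_0 : / 0 = 0.
Proof. apply injective_projections; simpl; unfold Rdiv; ring. Qed.

(** The case [p = 0] rests on the convention [/ 0 = 0]. The rule is used to factor
    [(q;q)_oo = (q;q)_n (q^(n+1);q)_oo] in a denominator. *)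
Lemma Cinv_mult_l (c p : C) : c <> 0 -> / (c * p) = / c * / p.
Proof.
  intros hc; destruct (Ceq_dec p 0) as [-> | hp].
  - rewrite Cmult_0_r, Cinv_0; ring.
  - field; now split.
Qed.

Lemma qbesselI2_wigert_sum (q : R) (nu : C) (lg : C -> C) (n : nat) :
  (0 < q < 1)%R -> is_log lg ->
  lg (qpow q (- (INR n / 2))) = - (INR n / 2) * ln q ->
  qbesselI2 lg nu (2 * qpow q (- (INR n / 2))) q
  = qpow q (- (nu * INR n / 2)) * (wigert_sum q n (qpow q (nu - INR n)) / qfac q n)
    / qpoch_inf (qpow q (INR n + 1)) q.
Proof.
  intros hq hlg hn; set (z := qpow q (- (INR n / 2))) in *.
  assert (hz2 : z ^ 2 * q ^ n = 1).
  { rewrite <- qpow_INR by lra; unfold z.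
    simpl; rewrite Cmult_1_r, <- !qpow_plus, <- (qpow_0 q); f_equal; field. }
  assert (hz : z <> 0).
  { intros E; rewrite E in hz2; simpl in hz2.
    rewrite !Cmult_0_l in hz2; apply RtoC_inj in hz2; lra. }
  rewrite (qbesselI2_phi11 q nu lg z hq hlg hz).
  replace (qpow q (nu + 1)) with (qpow q (nu - INR n) * q ^ S n).
  2: { rewrite <- qpow_INR, <- qpow_plus, INR_S_C by lra; f_equal; ring. }
  rewrite (phi11_terminating q n _ _ hq hz2).
  rewrite (qpoch_inf_split q q n hq), qpoch_qfac.
  replace (qpow q (INR n + 1)) with (q * q ^ n)
    by (rewrite qpow_plus, qpow_INR, qpow_1 by lra; ring).
  replace (cpow lg z nu) with (qpow q (- (nu * INR n / 2))).
  2: { unfold cpow, qpow; rewrite hn; f_equal; field; apply RtoC_neq_0; lra. }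
  unfold Cdiv; rewrite Cinv_mult_l; [ring | ].
  apply RtoC_neq_0, Rgt_not_eq, qfac_pos, hq.
Qed.

Theorem theorem2p1 (q : R) (nu : C) (lg : C -> C)
  (hq : (0 < q < 1)%R) (hlg : is_log lg) :
  (forall z : C, z <> 0 ->
     qbesselI2 lg nu (2 * z) q
     = cpow lg z nu / qpoch_inf q q * phi11 (z ^ 2) 0 q (qpow q (nu + 1)))
  /\
  (forall n : nat,
     (* the power of q^(-n/2) is taken with its real logarithm *)
     lg (qpow q (- (INR n / 2))) = - (INR n / 2) * ln q ->
     qbesselI2 lg nu (2 * qpow q (- (INR n / 2))) q
     = qpow q (nu * INR n / 2)
       * stieltjes_wigert n (- qpow q (- nu - INR n)) q
       / qpoch_inf (qpow q (INR n + 1)) q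
     /\
     qbesselI2 lg nu (2 * qpow q (- (INR n / 2))) q
     = qpow q (- (nu * INR n / 2))
       * stieltjes_wigert n (- qpow q (nu - INR n)) q
       / qpoch_inf (qpow q (INR n + 1)) q).
Proof.
  split; [now intros z; apply qbesselI2_phi11 | ].
  intros n hn; rewrite (qbesselI2_wigert_sum q nu lg n hq hlg hn).
  rewrite !stieltjes_wigert_opp by exact hq; split; [ | reflexivity].
  rewrite (wigert_sum_reverse q n _ (qpow q (- nu - INR n)) hq).
  - replace (qpow q (nu * INR n / 2))
      with (qpow q (- (nu * INR n / 2)) * (qpow q (nu - INR n) * q ^ n) ^ n).
    + unfold Cdiv; ring.
    + rewrite <- (qpow_INR q n), <- qpow_plus, <- qpow_INR_mult, <- qpow_plus by lra.
      f_equal; field; apply RtoC_neq_0; lra.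
  - rewrite <- qpow_INR, mult_INR, RtoC_mult, <- !qpow_plus, <- (qpow_0 q) by lra.
    f_equal; simpl INR; rewrite RtoC_plus; ring.
Qed.
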